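(* Let $k$ be a positive integer, and let $\eta(s)=\sum_{n=0}^{\infty}c_n s^{2n}$, $c_0=-k^2$, be a non-constant power series satisfying $$(s\eta'')^2+4\left((\eta')^2-\frac{1}{64}\right)(\eta-s\eta')-\frac{k^2}{4^2}=0 .$$ Then $$c_1=\frac{1}{64(4k^2-1)},$$ while for all $p\ge 2$ $$c_p=\frac{1}{2c_1p(2p-1)+(2p-1)/64-8pk^2c_1}\Bigg(4k^2\sum_{l=1}^{p-2}(l+1)(p-l)c_{l+1}c_{p-l}$$ $$\qquad-\sum_{l=1}^{p-2}(l+1)(p-l)(2l+1)(2p-2l-1)c_{l+1}c_{p-l}-4\sum_{l=1}^{p-1}(1-2l)c_lA_{p-l-1}\Bigg),$$ where $$A_q=\sum_{l=0}^{q}(l+1)(q-l+1)c_{l+1}c_{q-l+1}.$$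
   Context: Primes denote $d/ds$; empty sums are zero. Coefficients are complex; the differential equation is understood as an identity of power series in $s$. *)

(* Defs.v *)
From HB Require Import structures.
From mathcomp Require Import all_boot all_order all_algebra.
From mathcomp Require Import boolp reals.
From mathcomp Require Import complex.

Set Implicit Arguments.
Unset Strict Implicit.
Unset Printing Implicit Defensive.

Import GRing.Theory.

Local Open Scope ring_scope.

(* Formal power series. The record wrapper keeps the Cauchy product below from
   competing with a pointwise ring structure on nat -> R. *)
Record fps (R : Type) : Type := FPS { fps_coef : nat -> R }.

HB.instance Definition _ (R : Type) := gen_eqMixin (fps R).
HB.instance Definition _ (R : Type) := gen_choiceMixin (fps R).

Lemma fpsP (R : Type) (f g : fps R) : fps_coef f =1 fps_coef g <-> f = g.
Proof.
split=> [|-> //]; case: f => f; case: g => g /= fg.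
by congr FPS; apply/funext.
Qed.

Section FPSRing.
Variable R : comNzRingType.
Implicit Types (f g h : fps R).

Definition fpsC (a : R) : fps R := FPS (fun n => if n == 0%N then a else 0).
Definition fpsX : fps R := FPS (fun n => (n == 1%N)%:R).
Definition fps_deriv f : fps R := FPS (fun n => fps_coef f n.+1 *+ n.+1).

Definition fps_add f g : fps R := FPS (fun n => fps_coef f n + fps_coef g n).
Definition fps_opp f : fps R := FPS (fun n => - fps_coef f n).
Definition fps_mul f g : fps R :=
  FPS (fun n => \sum_(i < n.+1) fps_coef f i * fps_coef g (n - i)%N).

Fact fps_addA : associative fps_add.
Proof. by move=> f g h; apply/fpsP => n /=; rewrite addrA. Qed.
Fact fps_addC : commutative fps_add.
Proof. by move=> f g; apply/fpsP => n /=; rewrite addrC. Qed.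
Fact fps_add0 : left_id (fpsC 0) fps_add.
Proof. by move=> f; apply/fpsP => n /=; rewrite if_same add0r. Qed.
Fact fps_addN : left_inverse (fpsC 0) fps_opp fps_add.
Proof. by move=> f; apply/fpsP => n /=; rewrite if_same addNr. Qed.

HB.instance Definition _ :=
  GRing.isZmodule.Build (fps R) fps_addA fps_addC fps_add0 fps_addN.

Definition fps_trunc n f : {poly R} := \poly_(i < n.+1) fps_coef f i.

Lemma coef_fps_trunc n f i : (i <= n)%N -> (fps_trunc n f)`_i = fps_coef f i.
Proof. by move=> le_in; rewrite coef_poly ltnS le_in. Qed.

Lemma fps_coef_mul_trunc n f g m : (m <= n)%N ->
  fps_coef (fps_mul f g) m = (fps_trunc n f * fps_trunc n g)`_m.
Proof.
move=> le_mn; rewrite coefM /=; apply: eq_bigr => i _.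
rewrite !coef_fps_trunc ?(leq_trans (leq_subr _ _)) //.
by rewrite (leq_trans _ le_mn) // -ltnS.
Qed.

Fact fps_mulC : commutative fps_mul.
Proof. by move=> f g; apply/fpsP => n; rewrite !(@fps_coef_mul_trunc n) // mulrC. Qed.

Fact fps_mulA : associative fps_mul.
Proof.
move=> f g h; apply/fpsP => n.
have eqT (p q : {poly R}) r : (forall i, (i <= n)%N -> p`_i = q`_i) ->
    (p * r)`_n = (q * r)`_n.
  move=> pq; rewrite !coefM; apply: eq_bigr => i _.
  by rewrite pq // -ltnS.
have truncM f1 g1 i : (i <= n)%N ->
    (fps_trunc n (fps_mul f1 g1))`_i = (fps_trunc n f1 * fps_trunc n g1)`_i.
  by move=> le_in; rewrite coef_fps_trunc // (@fps_coef_mul_trunc n).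
rewrite fps_mulC !(@fps_coef_mul_trunc n) //.
rewrite (eqT _ _ _ (truncM g h)) (eqT _ _ _ (truncM f g)).
by rewrite mulrC mulrA.
Qed.

Fact fps_mul1 : left_id (fpsC 1) fps_mul.
Proof.
move=> f; apply/fpsP => n /=; rewrite big_ord_recl /= mul1r subn0.
by rewrite big1 ?addr0 // => i _; rewrite mul0r.
Qed.

Fact fps_mulDl : left_distributive fps_mul fps_add.
Proof.
move=> f g h; apply/fpsP => n /=; rewrite -big_split /=.
by apply: eq_bigr => i _; rewrite mulrDl.
Qed.

Fact fps_one_neq0 : fpsC 1 != fpsC 0.
Proof.
apply/eqP => /(congr1 (fun f => fps_coef f 0)) /= /eqP.
by rewrite oner_eq0.
Qed.

HB.instance Definition _ := GRing.Zmodule_isComNzRing.Build (fps R)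
  fps_mulA fps_mulC fps_mul1 fps_mulDl fps_one_neq0.

(* \sum_n c_n s^(2n) *)
Definition fps_even (c : nat -> R) : fps R :=
  FPS (fun n => if odd n then 0 else c n./2).

Definition fps_constant f : Prop := exists a : R, f = fpsC a.

Definition Aconv (c : nat -> R) (q : nat) : R :=
  \sum_(0 <= l < q.+1)
     (l + 1)%:R * (q - l + 1)%:R * c (l + 1)%N * c (q - l + 1)%N.

End FPSRing.

Arguments fpsX {R}.

(* Main.v *)
Require Import Defs.
From mathcomp Require Import all_boot all_order all_algebra.
From mathcomp Require Import boolp reals.
From mathcomp Require Import complex.
From mathcomp Require Import zify ring.
Import Order.TTheory GRing.Theory Num.Theory.
Local Open Scope ring_scope.

(** Put [t = s ^ 2].  For an even series [eta = \sum_n c_n t ^ n], both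
    [s eta''] and [eta'] are [s] times an even series, and [eta - s eta'] is
    even, so the differential equation becomes an identity between power series
    in [t].  Its coefficient of [t ^ (p + 1)], a quadratic plus a cubic
    convolution plus a linear term ([ode_even_coef]), gives everything:

    - If [c_1 = 0], then in every product [c_(l + 1) c_(m + 1)] with
      [l + m <= p] one factor is [c_1] or has index between [1] and [p]; by
      induction only the linear term [c_(p + 1)] survives, hence it vanishes and
      [eta] is constant ([even_rec_c1_neq0]).
    - For [p = 0] the relation is [c_1] times an affine expression in [c_1];
      cancelling [c_1] determines it ([even_rec_c1]).
    - For [p > 0] the relation is affine in its top coefficient [c_n], where
      [n = p + 1], and four times the denominator [D] for [c_n] is the slope
      ([even_rec_solved]).  Substituting the value of [c_1],
      [64 (4 k ^ 2 - 1) D = (2 n - 1) ^ 2 - (2 k) ^ 2], a difference of squares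
      of opposite parity, so one may divide ([denominator_neq0]). *)

(** * Even power series and the coefficients of the equation *)

Section FpsEven.
Variable R : comNzRingType.
Implicit Types (f g : fps R) (a b c : nat -> R).

Definition cauchy_prod a b (n : nat) : R := \sum_(i < n.+1) a i * b (n - i)%N.

Lemma fps_coef_mulrn f m n : fps_coef (f *+ m) n = fps_coef f n *+ m.
Proof.
elim: m => [|m IH]; first by rewrite /= if_same.
by rewrite !mulrS -IH.
Qed.

Lemma fps_coef_even_double a n : fps_coef (fps_even a) n.*2 = a n.
Proof. by rewrite /= odd_double doubleK. Qed.

Lemma fps_coef_mulC x f n : fps_coef (fpsC x * f) n = x * fps_coef f n.
Proof.
rewrite /= big_ord_recl /= subn0 big1 ?addr0 // => i _.
by rewrite mul0r.
Qed.

Lemma fps_coef_mulX f n :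
  fps_coef (fpsX * f) n = if n is m.+1 then fps_coef f m else 0.
Proof.
case: n => [|n] /=; first by rewrite big_ord_recl big_ord0 mul0r addr0.
rewrite !big_ord_recl /= mul0r add0r mul1r subSS subn0 big1 ?addr0 // => i _.
by rewrite mul0r.
Qed.

Lemma fps_even_mul a b : fps_even a * fps_even b = fps_even (cauchy_prod a b).
Proof.
apply/fpsP => n /=; rewrite /cauchy_prod.
(* Split the convolution by the parity of the index. *)
pose F i := (if odd i then 0 else a i./2) *
  (if odd (n - i) then 0 else b (n - i)./2).
rewrite -(big_mkord xpredT F).
have evE m : \sum_(0 <= i < m.*2) F i =
    \sum_(0 <= i < m) F i.*2 + \sum_(0 <= i < m) F i.*2.+1.
  elim: m => [|m IH]; first by rewrite !big_geq // addr0.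
  by rewrite doubleS !big_nat_recr //= IH; ring.
have oddF i : F i.*2.+1 = 0 by rewrite /F /= odd_double mul0r.
have [n_odd | n_even] := boolP (odd n).
  rewrite big_nat big1 // => i /andP[_ le_in].
  by rewrite /F oddB // n_odd; case: (odd i); rewrite /= ?mul0r ?mulr0.
rewrite -[in n.+1](even_halfK n_even) big_nat_recr //= evE.
rewrite [X in _ + X + _]big1 => [|i _]; last exact: oddF.
rewrite addr0 -(big_nat_recr _ _ (fun i => F i.*2)) // big_mkord.
apply: eq_bigr => i _.
have nB : (n - i.*2)%N = (n./2 - i).*2 by rewrite doubleB even_halfK.
by rewrite /F nB !odd_double !doubleK.
Qed.

(** Products of two odd series, such as [(s eta'') ^ 2] and [eta' ^ 2], enter
    the equation in this form. *)
Lemma fps_coef_mulXX_even a p :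
  fps_coef (fpsX ^+ 2 * fps_even a) p.+1.*2 = a p.
Proof.
by rewrite expr2 -mulrA doubleS !fps_coef_mulX /= odd_double doubleK.
Qed.

Lemma fps_deriv_even c :
  fps_deriv (fps_even c) = fpsX * fps_even (fun n => c n.+1 *+ n.+1.*2).
Proof.
apply/fpsP => -[|n]; rewrite fps_coef_mulX /= ?mul0rn ?negbK //.
by case: ifP => [_|/negbT n_even]; rewrite ?mul0rn // doubleS even_halfK.
Qed.

Lemma fps_deriv2_even c :
  fps_deriv (fps_deriv (fps_even c)) =
  fps_even (fun n => c n.+1 *+ (n.+1.*2 * n.*2.+1)).
Proof.
apply/fpsP => n; rewrite /= negbK.
case: ifP => [_|/negbT n_even]; first by rewrite !mul0rn.
by rewrite -mulrnA doubleS even_halfK // mulnC.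
Qed.

Lemma fps_sub_mulX_deriv_even c :
  fps_even c - fpsX * fps_deriv (fps_even c) =
  fps_even (fun n => (1 - 2%:R * n%:R) * c n).
Proof.
apply/fpsP => n; change (fps_coef (fps_even c) n -
  fps_coef (fpsX * fps_deriv (fps_even c)) n = fps_coef (fps_even
  (fun n => (1 - 2%:R * n%:R) * c n)) n).
rewrite fps_coef_mulX; case: n => [|n] /=; first by ring.
case: ifP => [_|/negbFE n_odd]; first by rewrite mul0rn subr0.
have -> : (n.+1 = (uphalf n).*2)%N by rewrite odd_uphalfK.
by rewrite -muln2; ring.
Qed.

Lemma cauchy_prod_deriv_even c n :
  cauchy_prod (fun n => c n.+1 *+ n.+1.*2) (fun n => c n.+1 *+ n.+1.*2) n =
  4%:R * Aconv c n.
Proof.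
rewrite /Aconv big_mkord big_distrr /=; apply: eq_bigr => i _.
by rewrite -!muln2 !addn1; ring.
Qed.

(** What the differential equation, with [x] in place of [1 / 64], says about
    the coefficient of [s ^ (2 p + 2)]; the coefficient of [s ^ 0] only fixes
    the constant term and is left out. *)
Definition even_rec (x : R) c : Prop := forall p,
  4%:R * (\sum_(0 <= l < p.+1) (l + 1)%:R * (p.+1 - l)%:R * (2 * l + 1)%:R
            * (2 * p.+1 - 2 * l - 1)%:R * c (l + 1)%N * c (p.+1 - l)%N)
  + 16%:R * (\sum_(0 <= l < p.+1)
                (1 - 2%:R * l%:R) * c l * Aconv c (p.+1 - l - 1))
  - 4%:R * x * (1 - 2%:R * p.+1%:R) * c p.+1 = 0.

Lemma ode_even_coef (x y : R) c :
  let eta := fps_even c in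
  (fpsX * fps_deriv (fps_deriv eta)) ^+ 2
    + 4%:R * (fps_deriv eta ^+ 2 - fpsC x) * (eta - fpsX * fps_deriv eta)
    - fpsC y = 0 ->
  even_rec x c.
Proof.
move=> eta; rewrite fps_deriv2_even fps_sub_mulX_deriv_even.
rewrite fps_deriv_even !exprMn ![fps_even _ ^+ 2]expr2 !fps_even_mul.
set u := cauchy_prod _ _; set v := cauchy_prod _ _; set w := fun n => _.
rewrite [X in X = 0](_ : _ = fpsX ^+ 2 * fps_even u
  + (fpsX ^+ 2 * (fps_even v * fps_even w)) *+ 4
  + - ((fpsC x * fps_even w) *+ 4) + - fpsC y); last by ring.
rewrite fps_even_mul => ode p.
have := congr1 (fun f => fps_coef f p.+1.*2) ode.
rewrite [LHS](_ : _ = fps_coef (fpsX ^+ 2 * fps_even u) p.+1.*2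
  + fps_coef ((fpsX ^+ 2 * fps_even (cauchy_prod v w)) *+ 4) p.+1.*2
  - fps_coef ((fpsC x * fps_even w) *+ 4) p.+1.*2
  - fps_coef (fpsC y) p.+1.*2) //.
rewrite !fps_coef_mulrn !fps_coef_mulXX_even fps_coef_mulC fps_coef_even_double.
rewrite subr0 => coef_eq0; rewrite -[RHS]coef_eq0 !big_mkord; congr (_ + _ - _).
- rewrite big_distrr /=; apply: eq_bigr => i _.
  have le_ip : (i <= p)%N by rewrite -ltnS.
  rewrite subSn // !addn1 -!muln2.
  rewrite (_ : (2 * p.+1 - 2 * i - 1 = 2 * (p - i) + 1)%N); last by lia.
  ring.
(* [Aconv] comes from [eta' ^ 2], the first factor; reversing the convolution
   puts the factor [c l] of the other series first. *)
- rewrite /cauchy_prod [in RHS](reindex_inj rev_ord_inj) /= big_distrr -sumrMnl.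
  apply: eq_bigr => i _; have le_ip : (i <= p)%N by rewrite -ltnS.
  rewrite /v cauchy_prod_deriv_even /w subSS subKn // subSn // subn1 /=; ring.
- rewrite /w; ring.
Qed.
End FpsEven.

Arguments even_rec {R}.

(** * Consequences of the recurrence *)

Section Recurrence.
Variable K : numFieldType.
Implicit Types (c : nat -> K) (k p q : nat).

Lemma Aconv_subS c q :
  Aconv c q =
  \sum_(0 <= l < q.+1) (l + 1)%:R * (q.+1 - l)%:R * c (l + 1)%N * c (q.+1 - l)%N.
Proof.
rewrite /Aconv !big_mkord; apply: eq_bigr => i _.
by rewrite addn1 subSn ?addn1 // -ltnS.
Qed.

(** If [c_1] vanished, the linear term would force all later coefficients to
    vanish in turn. *)
Lemma even_rec_c1_neq0 (x : K) c :
  x != 0 -> even_rec x c -> ~ fps_constant (fps_even c) -> c 1%N != 0.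
Proof.
move=> x_neq0 rec c_nconst; apply/eqP => c1_eq0; apply: c_nconst.
have c_eq0 : forall p, c p.+1 = 0.
  elim/ltn_ind => p IH.
  have prod0 l m : (l + m <= p)%N -> c l.+1 * c m.+1 = 0.
    case: (ltnP l p) => [lt_lp|le_pl] le_p; first by rewrite IH ?mul0r.
    by rewrite (_ : m = 0%N) ?c1_eq0 ?mulr0 //; lia.
  have A0 q : (q <= p)%N -> Aconv c q = 0.
    move=> le_qp; rewrite /Aconv big_nat big1 // => l /andP[_ le_lq].
    by rewrite -mulrA !addn1 prod0 ?mulr0 //; lia.
  have := rec p; rewrite big_nat big1 => [|l /andP[_ le_lp]]; last first.
    by rewrite -mulrA addn1 subSn // prod0 ?mulr0 //; lia.
  rewrite big1 => [|l _]; last by rewrite A0 ?mulr0 //; lia.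
  rewrite !mulr0 addr0 sub0r => /eqP; rewrite oppr_eq0 !mulf_eq0.
  rewrite pnatr_eq0 (negbTE x_neq0) /= subr_eq0 -natrM.
  by rewrite [1 == _](eqr_nat K 1) => /orP[/eqP|/eqP //]; lia.
exists (c 0%N); apply/fpsP => -[|n] //=.
by case: ifP => //; case: n => // n _; rewrite c_eq0.
Qed.

Lemma four_sqr_sub1_neq0 k : (4%:R * k%:R ^+ 2 - 1 : K) != 0.
Proof.
by rewrite subr_eq0 -natrX -natrM (eqr_nat K _ 1); apply/eqP; lia.
Qed.

Lemma even_rec_c1 k c : even_rec (1 / 64%:R) c -> c 0%N = - k%:R ^+ 2 ->
  c 1%N != 0 -> c 1%N = 1 / (64%:R * (4%:R * k%:R ^+ 2 - 1)).
Proof.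
move=> rec c0 c1_neq0; have D_neq0 := four_sqr_sub1_neq0 k.
apply: (mulfI c1_neq0); apply: (mulfI D_neq0).
have := rec 0%N; rewrite !big_nat1 Aconv_subS big_nat1 /= c0 !subn0 muln0 !add0n.
rewrite (_ : (2 * 1 - 1 = 1)%N) // => rec0.
(* The difference of the two sides is the relation times [- 1 / 4]. *)
apply/eqP; rewrite -subr_eq0 -[X in _ == X](mulr0 (- 4%:R^-1)) -rec0.
by apply/eqP; field.
Qed.

(** A difference of squares of an odd and an even integer is nonzero. *)
Lemma denominator_neq0 k p (d : K) : (0 < p)%N ->
  d = 1 / (64%:R * (4%:R * k%:R ^+ 2 - 1)) ->
  2%:R * d * p%:R * (2%:R * p%:R - 1) + (2%:R * p%:R - 1) / 64%:R
    - 8%:R * p%:R * k%:R ^+ 2 * d != 0.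
Proof.
move=> p_gt0 ->; have D_neq0 := four_sqr_sub1_neq0 k.
rewrite (_ : _ - _ = ((2 * p - 1)%:R ^+ 2 - (2 * k)%:R ^+ 2)
                     / (64%:R * (4%:R * k%:R ^+ 2 - 1))); last first.
  by rewrite natrB ?muln_gt0 // !natrM; field.
rewrite mulf_neq0 ?invr_neq0 ?mulf_neq0 ?pnatr_eq0 //.
rewrite subr_eq0 -!natrX eqr_nat eqn_sqr.
by apply/eqP; lia.
Qed.

(** The recurrence at [p] is linear in [c p]: this coefficient occurs only in
    the extreme terms of the convolutions and in the linear term, and
    collecting these occurrences gives the denominator. *)
Lemma even_rec_solved k c p (d := c 1%N) :
  even_rec (1 / 64%:R) c -> c 0%N = - k%:R ^+ 2 -> (2 <= p)%N ->
  (2%:R * d * p%:R * (2%:R * p%:R - 1) + (2%:R * p%:R - 1) / 64%:R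
    - 8%:R * p%:R * k%:R ^+ 2 * d) * c p =
  4%:R * k%:R ^+ 2 *
    (\sum_(1 <= l < p.-1) (l + 1)%:R * (p - l)%:R * c (l + 1)%N * c (p - l)%N)
  - (\sum_(1 <= l < p.-1)
       (l + 1)%:R * (p - l)%:R * (2 * l + 1)%:R * (2 * p - 2 * l - 1)%:R
         * c (l + 1)%N * c (p - l)%N)
  - 4%:R * (\sum_(1 <= l < p) (1 - 2%:R * l%:R) * c l * Aconv c (p - l - 1)).
Proof.
move=> rec c0; case: p => [|[|q]] // _; rewrite -[q.+2.-1]/(q.+1).
have := rec q.+1.
rewrite [\sum_(0 <= l < q.+2) _]big_nat_recr // [\sum_(0 <= l < q.+1) _]big_ltn //.
rewrite [\sum_(0 <= l < q.+2) _]big_ltn // (_ : (q.+2 - 0 - 1 = q.+1)%N) // Aconv_subS.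
rewrite [\sum_(0 <= l < q.+2) _]big_nat_recr // [\sum_(0 <= l < q.+1) _]big_ltn //.
rewrite !muln0 !subn0 subSnn !add0n !addn1 c0 -/d /=.
rewrite (_ : (2 * q.+2 - 2 * q.+1 - 1 = 1)%N); last by lia.
rewrite (_ : (2 * q.+2 - 1 = 2 * q + 3)%N); last by lia.
set S2 := \sum_(1 <= l < q.+1) _; set S1 := \sum_(1 <= l < q.+1) _.
set S3 := \sum_(1 <= l < q.+2) _ => rec_q.
(* The difference of the two sides is a quarter of the relation. *)
apply/eqP; rewrite -subr_eq0 -[X in _ == X](mulr0 (4%:R^-1)) -rec_q.
by apply/eqP; field.
Qed.
End Recurrence.

Theorem proposition5p1 (R : realType) (k : nat) (c : nat -> R[i])
    (eta := fps_even c) (eta' := fps_deriv eta) (eta'' := fps_deriv eta') :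
  (0 < k)%N ->
  c 0%N = - k%:R ^+ 2 ->
  ~ fps_constant eta ->
  (fpsX * eta'') ^+ 2
    + 4%:R * (eta' ^+ 2 - fpsC (1 / 64%:R)) * (eta - fpsX * eta')
    - fpsC (k%:R ^+ 2 / 4%:R ^+ 2) = 0 ->
  c 1%N = 1 / (64%:R * (4%:R * k%:R ^+ 2 - 1)) /\
  forall p : nat, (2 <= p)%N ->
    let D : R[i] :=
      2%:R * c 1%N * p%:R * (2%:R * p%:R - 1) + (2%:R * p%:R - 1) / 64%:R
        - 8%:R * p%:R * k%:R ^+ 2 * c 1%N in
    D != 0 /\
    c p = 1 / D *
      (4%:R * k%:R ^+ 2 *
         (\sum_(1 <= l < p.-1)
            (l + 1)%:R * (p - l)%:R * c (l + 1)%N * c (p - l)%N)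
       - (\sum_(1 <= l < p.-1)
            (l + 1)%:R * (p - l)%:R * (2 * l + 1)%:R * (2 * p - 2 * l - 1)%:R
              * c (l + 1)%N * c (p - l)%N)
       - 4%:R * (\sum_(1 <= l < p)
            (1 - 2%:R * l%:R) * c l * Aconv c (p - l - 1))).
Proof.
move=> _ c0 c_nconst ode; have rec := ode_even_coef R[i] _ _ _ ode.
have x_neq0 : 1 / 64%:R != 0 :> R[i] by rewrite mul1r invr_neq0 ?pnatr_eq0.
have c1_neq0 := even_rec_c1_neq0 R[i] _ _ x_neq0 rec c_nconst.
have c1E := even_rec_c1 R[i] _ _ rec c0 c1_neq0.
split=> // p p_ge2 D.
have D_neq0 : D != 0.
  exact: (denominator_neq0 _ _ _ _ (ltnW p_ge2) c1E).
split=> //; rewrite -(even_rec_solved R[i] _ _ _ rec c0 p_ge2) -/D.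
by rewrite mul1r mulKf.
Qed.
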